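(* Let $k\ge2$ be an integer and let $P'_{8\cdot3^k}=\langle x,y,z\mid x^2=(xy)^2=y^2,\ zxz^{-1}=y,\ zyz^{-1}=xy,\ z^{3^k}=1\rangle$. The $7\cdot3^{k-1}$ irreducible complex characters of $P'_{8\cdot3^k}$ are, without repetition, the characters $\chi_j$ of $\alpha_j$ and $\psi_j$ of $\varrho_j$ for $0\le j\le3^k-1$, and $\varphi_s$ of $\varsigma_s$ for $0\le s\le3^{k-1}-1$. Their values on the conjugacy classes $\mathsf{1}_l,\mathsf{1}_l^{+},\mathsf{4}_l^{a},\mathsf{4}_l^{b},\mathsf{4}_l^{c},\mathsf{4}_l^{d},\mathsf{6}_l$ ($0\le l\le3^{k-1}-1$) are, in this order and with $\zeta=\zeta_{3^k}=e^{2\pi i/3^k}$: - $\chi_j$: $\ \zeta^{3lj},\ \zeta^{3lj},\ \zeta^{(3l+1)j},\ \zeta^{(3l+2)j},\ \zeta^{(3l+1)j},\ \zeta^{(3l+2)j},\ \zeta^{3lj}$; - $\psi_j$: $\ 2\zeta^{3lj},\ -2\zeta^{3lj},\ -\zeta^{(3l+1)j},\ -\zeta^{(3l+2)j},\ \zeta^{(3l+1)j},\ \zeta^{(3l+2)j},\ 0$; - $\varphi_s$: $\ 3\zeta^{3ls},\ 3\zeta^{3ls},\ 0,\ 0,\ 0,\ 0,\ -\zeta^{3ls}$.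
   Context: Put $\zeta_n=e^{2\pi i/n}$. The representations are: - $\alpha_j(z)=\zeta_{3^k}^j$, $\alpha_j(x)=\alpha_j(y)=1$; - $\varrho_j(x)=\begin{pmatrix}0&\zeta_3^2\\-\zeta_3&0\end{pmatrix}$, $\varrho_j(y)=\begin{pmatrix}\zeta_3^2&1\\\zeta_3^2&-\zeta_3^2\end{pmatrix}$, $\varrho_j(z)=\zeta_{3^k}^j\begin{pmatrix}0&\zeta_3\\-\zeta_3^2&-1\end{pmatrix}$; - $\varsigma_s(x)=\begin{pmatrix}-1&-1&-1\\0&0&1\\0&1&0\end{pmatrix}$, $\varsigma_s(y)=\begin{pmatrix}0&0&1\\-1&-1&-1\\1&0&0\end{pmatrix}$, $\varsigma_s(z)=\zeta_{3^k}^s\begin{pmatrix}-1&-1&-1\\0&1&0\\1&0&0\end{pmatrix}$. The conjugacy classes are, for $0\le l\le3^{k-1}-1$: $\mathsf{1}_l=\{z^{3l}\}$; $\mathsf{1}_l^{+}=\{x^2z^{3l}\}$; $\mathsf{4}_l^{a}=\{z^{3l+1},x^3z^{3l+1},x^2yz^{3l+1},x^3yz^{3l+1}\}$; $\mathsf{4}_l^{b}=\{z^{3l+2},xz^{3l+2},yz^{3l+2},xyz^{3l+2}\}$; $\mathsf{4}_l^{c}=\{xz^{3l+1},x^2z^{3l+1},yz^{3l+1},xyz^{3l+1}\}$; $\mathsf{4}_l^{d}=\{x^2z^{3l+2},x^3z^{3l+2},x^2yz^{3l+2},x^3yz^{3l+2}\}$; $\mathsf{6}_l=\{xz^{3l},yz^{3l},x^3z^{3l},xyz^{3l},x^2yz^{3l},x^3yz^{3l}\}$.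 *)

(* Defs.v *)
From mathcomp Require Import all_boot all_order all_algebra all_fingroup.
From mathcomp Require Import all_solvable all_field all_character.

Set Implicit Arguments.
Unset Strict Implicit.
Unset Printing Implicit Defensive.

Import GRing.Theory Num.Theory.
Local Open Scope ring_scope.

(* [n.-root (-1)] is the n-th root of -1 of least nonnegative argument, that is
   e^{i pi / n}; its square is e^{2 i pi / n}. ([n.-root 1] would be 1.) *)
Definition zeta (n : nat) : algC := (n.-root (-1)) ^+ 2.

Definition mx_of_rows (n : nat) (rows : seq (seq algC)) : 'M[algC]_n :=
  \matrix_(i < n, j < n) nth 0 (nth [::] rows i) j.

(* G is the group < x, y, z | x^2 = (xy)^2 = y^2, z x z^-1 = y, z y z^-1 = xy,
   z^(3^k) = 1 > with its distinguished generators. The abstract group being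
   finite, [\isog Grp] is isomorphism with it; as a surjective endomorphism of a
   finite group is bijective, the last two clauses say that this isomorphism can
   be chosen to match x, y, z with the abstract generators. *)
Definition P'8_3 (k : nat) (gT : finGroupType) (G : {group gT}) (x y z : gT)
    : Prop :=
  [/\ (G \isog Grp (x : y : z :
        (x ^+ 2 = (x * y) ^+ 2 = y ^+ 2, z * x * z^-1 = y, z * y * z^-1 = x * y,
         z ^+ (3 ^ k)%N = 1)))%g,
      G = <<[set x; y; z]>>%G
    & [/\ (x ^+ 2 = (x * y) ^+ 2)%g, ((x * y) ^+ 2 = y ^+ 2)%g,
          (z * x * z^-1 = y)%g, (z * y * z^-1 = x * y)%g
        & (z ^+ (3 ^ k)%N = 1)%g]].

Definition alpha_x : 'M[algC]_1 := 1%:M.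
Definition alpha_y : 'M[algC]_1 := 1%:M.
Definition alpha_z (k j : nat) : 'M[algC]_1 := (zeta (3 ^ k) ^+ j)%:M.

Definition rho_x : 'M[algC]_2 :=
  mx_of_rows 2 [:: [:: 0;         zeta 3 ^+ 2];
                   [:: - zeta 3;  0          ]].
Definition rho_y : 'M[algC]_2 :=
  mx_of_rows 2 [:: [:: zeta 3 ^+ 2;  1               ];
                   [:: zeta 3 ^+ 2;  - (zeta 3 ^+ 2) ]].
Definition rho_z (k j : nat) : 'M[algC]_2 :=
  zeta (3 ^ k) ^+ j *:
  mx_of_rows 2 [:: [:: 0;                zeta 3];
                   [:: - (zeta 3 ^+ 2);  -1    ]].

Definition sigma_x : 'M[algC]_3 :=
  mx_of_rows 3 [:: [:: -1; -1; -1];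
                   [::  0;  0;  1];
                   [::  0;  1;  0]].
Definition sigma_y : 'M[algC]_3 :=
  mx_of_rows 3 [:: [::  0;  0;  1];
                   [:: -1; -1; -1];
                   [::  1;  0;  0]].
Definition sigma_z (k s : nat) : 'M[algC]_3 :=
  zeta (3 ^ k) ^+ s *:
  mx_of_rows 3 [:: [:: -1; -1; -1];
                   [::  0;  1;  0];
                   [::  1;  0;  0]].

(* The sets 1_l, 1_l^+, 4_l^a, 4_l^b, 4_l^c, 4_l^d, 6_l, in this order. *)
Definition class_sets (gT : finGroupType) (x y z : gT) (l : nat)
    : seq {set gT} :=
  let z0 := (z ^+ (3 * l))%g in
  let z1 := (z ^+ (3 * l + 1))%g in
  let z2 := (z ^+ (3 * l + 2))%g in
  [:: [set z0];
      [set x ^+ 2 * z0];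
      [set z1; x ^+ 3 * z1; x ^+ 2 * y * z1; x ^+ 3 * y * z1];
      [set z2; x * z2; y * z2; x * y * z2];
      [set x * z1; x ^+ 2 * z1; y * z1; x * y * z1];
      [set x ^+ 2 * z2; x ^+ 3 * z2; x ^+ 2 * y * z2; x ^+ 3 * y * z2];
      [set x * z0; y * z0; x ^+ 3 * z0; x * y * z0;
           x ^+ 2 * y * z0; x ^+ 3 * y * z0]]%g.

Definition chi_values (k j l : nat) : seq algC :=
  let w := zeta (3 ^ k) in
  [:: w ^+ (3 * l * j); w ^+ (3 * l * j);
      w ^+ ((3 * l + 1) * j); w ^+ ((3 * l + 2) * j);
      w ^+ ((3 * l + 1) * j); w ^+ ((3 * l + 2) * j);
      w ^+ (3 * l * j)].

Definition psi_values (k j l : nat) : seq algC :=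
  let w := zeta (3 ^ k) in
  [:: 2 * w ^+ (3 * l * j); - 2 * w ^+ (3 * l * j);
      - w ^+ ((3 * l + 1) * j); - w ^+ ((3 * l + 2) * j);
      w ^+ ((3 * l + 1) * j); w ^+ ((3 * l + 2) * j);
      0].

Definition phi_values (k s l : nat) : seq algC :=
  let w := zeta (3 ^ k) in
  [:: 3 * w ^+ (3 * l * s); 3 * w ^+ (3 * l * s);
      0; 0; 0; 0;
      - w ^+ (3 * l * s)].

(* phi is constant on each listed set, with the value at the same position. *)
Definition has_values (gT : finGroupType) (G : {group gT}) (phi : 'CF(G))
    (sets : seq {set gT}) (vals : seq algC) : bool :=
  all2 (fun (C : {set gT}) v => [forall g in C, phi g == v]) sets vals.

(* Main.v *)
Require Import Defs.
From mathcomp Require Import all_boot all_order all_algebra all_fingroup.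
From mathcomp Require Import all_solvable all_field all_character.
From mathcomp Require Import ring.

Set Implicit Arguments.
Unset Strict Implicit.
Unset Printing Implicit Defensive.

Import Order.TTheory GRing.Theory Num.Theory.
Local Open Scope ring_scope.

(* Every element of G is a word x^i y^j z^c with x^i y^j in the quaternion group
   Q8 = <x, y>. These 8 * 3^k words are distinct, since G maps onto a group acting
   regularly on Q8 x Z/3^k. Hence matrices satisfying the relations extend to a
   representation of G, and the class of q z^c can be computed in Q8 alone, as it
   depends only on q and on c mod 3.
   The three families have values a^c t(q, c mod 3) at q z^c, where a is a root
   of unity and t an integer table with sum of squares 24, so these characters
   have norm 1. They are 7 * 3^(k-1) distinct irreducible characters, while the
   listed sets include every class and are 7 * 3^(k-1) in number: both lists are
   exact and free of repetition. *)

(** * Primitivity of [zeta n] *)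

(** In angles, [w] = e^{it} and [h] = e^{iu} with 0 < t < u <= pi, so the argument u - 2t of
    [h / w ^+ 2] has smaller absolute value than u. The difference of the real parts is 2 sin t
    sin(u - t). *)
Lemma Re_lt_div_sqr (w h : algC) :
  `|w| = 1 -> `|h| = 1 -> 0 < 'Im w -> 0 <= 'Im h -> 'Re h < 'Re w ->
  'Re h < 'Re (h / w ^+ 2).
Proof.
move=> w1 h1 b_gt0 s_ge0 lt_ca.
have hw : 'Re w ^+ 2 + 'Im w ^+ 2 = 1 by rewrite -normC2_Re_Im w1 expr1n.
have hh : 'Re h ^+ 2 + 'Im h ^+ 2 = 1 by rewrite -normC2_Re_Im h1 expr1n.
have -> : h / w ^+ 2 = h * w^* ^+ 2.
  have : w * w^* = 1 by rewrite -normCK w1 expr1n.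
  have : w != 0 by rewrite -normr_gt0 w1.
  by move=> w0 ww; apply: (canLR (mulfK _)); rewrite ?expf_neq0 // -mulrA
    -exprMn [_ * w]mulrC ww expr1n mulr1.
have -> : 'Re (h * w^* ^+ 2) =
   'Re h * ('Re w ^+ 2 - 'Im w ^+ 2) + 'Im h * ('Re w * 'Im w *+ 2).
  rewrite expr2 !ReM !ImM Re_conj Im_conj; ring.
move: (Creal_Re w) (Creal_Re h).
move: ('Re w) ('Im w) ('Re h) ('Im h) hw hh b_gt0 s_ge0 lt_ca.
move=> a b c s hw hh b_gt0 s_ge0 lt_ca aR cR.
have hs : s ^+ 2 = 1 - c ^+ 2 by rewrite -hh addrC addKr.
have hb : b ^+ 2 = 1 - a ^+ 2 by rewrite -hw addrC addKr.
rewrite -subr_gt0.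
have -> : c * (a ^+ 2 - b ^+ 2) + s * (a * b *+ 2) - c =
          2 * b * (a * s - b * c).
  have -> : 2 * b * (a * s - b * c) = 2 * b * a * s - 2 * b ^+ 2 * c by ring.
  by rewrite hb; ring.
have bs_gt0 : 0 < b + s by rewrite ltr_wpDr.
(* The factor [a * s - b * c] is sin(u - t). Multiplying it by [b + s] makes [a - c], known to be
   positive, appear as a factor; twice the cofactor is |w + h|^2. *)
rewrite !pmulr_rgt0 // -(pmulr_lgt0 _ bs_gt0).
have -> : (a * s - b * c) * (b + s) = (1 + a * c + b * s) * (a - c).
  have -> : (a * s - b * c) * (b + s) =
            a * b * s + a * s ^+ 2 - b ^+ 2 * c - b * c * s by ring.
  by rewrite hs hb; ring.
rewrite pmulr_lgt0 ?subr_gt0 // -(pmulr_rgt0 _ (ltr0n _ 2)).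
have -> : 2 * (1 + a * c + b * s) = (a + c) ^+ 2 + (b + s) ^+ 2.
  have -> : (a + c) ^+ 2 + (b + s) ^+ 2 =
            a ^+ 2 + c ^+ 2 + b ^+ 2 + s ^+ 2 + 2 * (a * c + b * s) by ring.
  by rewrite hs hb; ring.
by rewrite ltr_wpDl ?exprn_gt0 ?real_exprn_even_ge0 // rpredD.
Qed.

(* [w := n.-root (-1)] has the largest real part among the n-th roots of -1. All
   of these are powers of [w]: an exception [h] of largest real part would be
   beaten by [h / w ^+ 2]. *)
Lemma zeta_prim n : (0 < n)%N -> n.-primitive_root (zeta n).
Proof.
case: n => // [[_|n _]].
  rewrite /zeta root1C sqrrN expr1n.
  by have [w w1] := C_prim_root_exists (isT : (0 < 1)%N);
    have := w1; rewrite -[w]expr1 (prim_expr_order w1).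
rewrite /zeta; set w := _.-root _; set N := n.+2.
have wN : w ^+ N = -1 by rewrite rootCK.
have w2N : w ^+ (2 * N) = 1 by rewrite mulnC exprM wN sqrrN expr1n.
have norm1 (h : algC) : h ^+ N = -1 -> `|h| = 1.
  move=> hN; apply/eqP; rewrite -(@pexpr_eq1 _ _ N) // -normrX hN.
  by rewrite normrN normr1.
have conj_inv (h : algC) : h ^+ N = -1 -> h^* = h^-1.
  by move=> hN; rewrite invC_norm norm1 // expr1n invr1 mul1r.
have [v v_prim] := C_prim_root_exists (isT : (0 < 2 * N)%N).
have v2N : v ^+ (2 * N) = 1 by apply: prim_expr_order.
have v2 : v ^+ 2 != 1.
  by rewrite -(prim_order_dvd v_prim) -[X in (_ %| X)%N]muln1 dvdn_pmul2l.
have vN : v ^+ N = -1.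
  have /eqP := v2N; rewrite mulnC exprM sqrf_eq1 => /orP[] /eqP // vN.
  have := prim_order_dvd v_prim N; rewrite vN eqxx.
  move=> /(dvdn_leq (isT : 0 < N)%N).
  by rewrite mul2n -addnn -{3}[N]add0n leq_add2r.
have w_neq0 : w != 0 by rewrite -normr_gt0 norm1.
have Re_max (h : algC) : h ^+ N = -1 -> 'Re h <= 'Re w.
  move=> hN; have [|/ltW] := real_leP (rpred0 _) (Creal_Im h).
    by apply: rootC_Re_max.
  rewrite -oppr_ge0 -Im_conj -Re_conj; apply: rootC_Re_max => //.
  by rewrite -rmorphXn hN rmorphN rmorph1.
have real_sqr (h : algC) : h ^+ N = -1 -> 'Im h = 0 -> h ^+ 2 = 1.
  by move=> hN /Creal_ImP hR; rewrite -real_normK ?norm1 ?expr1n.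
have Im_w : 0 < 'Im w.
  rewrite lt_def Im_rootC_ge0 // andbT; apply/eqP => Im_w0.
  have /eqP := real_sqr w wN Im_w0; rewrite sqrf_eq1 => /orP[] /eqP w1.
    by move: wN; rewrite w1 expr1n => /esym /eqP; rewrite eqNr oner_eq0.
  (* If [w] were -1, maximality would give Re v <= -1, so [v] would be real with square 1, against
     its order 2N > 2. *)
  have /eqP := norm1 v vN; rewrite -(@pexpr_eq1 _ _ 2) // normC2_Re_Im.
  move/eqP=> v1.
  case/eqP: v2; apply: real_sqr => //; apply/eqP; rewrite -sqrf_eq0 eq_le.
  rewrite real_exprn_even_ge0 ?Creal_Im // andbT -(lerD2l ('Re v ^+ 2)) v1.
  rewrite addr0.
  rewrite -sqrrN exprn_ege1 // lerNr (le_trans (Re_max v vN)) // w1.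
  by rewrite raddfN /= (Creal_ReP _ _) ?rpred1.
have better (h : algC) : h ^+ N = -1 -> ~ (exists i, h = w ^+ i) ->
    exists2 h' : algC, h' ^+ N = -1 /\ ~ (exists i, h' = w ^+ i)
                     & 'Re h < 'Re h'.
  wlog Im_h : h / 0 <= 'Im h => [IH hN h_bad|hN h_bad].
    have [|/ltW] := real_leP (rpred0 _) (Creal_Im h); first by move/IH; apply.
    rewrite -oppr_ge0 -Im_conj -Re_conj; move/IH; apply.
      by rewrite -rmorphXn hN rmorphN rmorph1.
    (* Passing to the conjugate keeps exceptions: if h^-1 = w^i then h = w^(-i), and -i is i(2N - 1)
       modulo 2N. *)
    rewrite conj_inv // => -[i hi]; apply: h_bad; exists (i * (2 * N).-1)%N.
    rewrite exprM -hi exprVn -[LHS]invrK; congr _^-1.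
    apply: (mulfI (_ : h != 0)); first by rewrite -normr_gt0 norm1.
    by rewrite -exprS prednK // mulnC exprM hN sqrrN expr1n mulfV
       // -normr_gt0 norm1.
  exists (h / w ^+ 2).
    split; first by rewrite exprMn hN exprVn -exprM w2N invr1 mulr1.
    case=> i hi; apply: h_bad; exists (i + 2)%N.
    by rewrite exprD -hi divfK ?expf_neq0.
  apply: Re_lt_div_sqr; rewrite ?norm1 // lt_neqAle Re_max // andbT.
  (* Equal real parts would force equal imaginary parts, both being nonnegative, and then [h] =
     [w]. *)
  apply/eqP => Re_hw; apply: h_bad; exists 1%N; rewrite expr1.
  have := congr1 (fun t => t ^+ 2) (norm1 h hN); rewrite -(norm1 w wN).
  rewrite !normC2_Re_Im Re_hw => /addrI /eqP; rewrite eqrXn2 ?(ltW Im_w) //.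
  by move=> /eqP Im_hw; rewrite [h]algCrect Re_hw Im_hw -algCrect.
have wv_mod i : w ^+ i = w ^+ (i %% (2 * N)).
  by rewrite {1}(divn_eq i (2 * N)) exprD mulnC exprM w2N expr1n mul1r.
(* Exceptions are indexed by exponents of [v], a finite type, so that one of largest real part can
   be chosen. *)
pose bad (i : 'I_(2 * N)) :=
  (v ^+ i ^+ N == -1) && [forall j : 'I_(2 * N), v ^+ i != w ^+ j].
have badP (h : algC) : h ^+ N = -1 -> ~ (exists i, h = w ^+ i) ->
    exists2 i, bad i & h = v ^+ i.
  move=> hN h_bad; have h2N : h ^+ (2 * N) = 1.
    by rewrite mulnC exprM hN sqrrN expr1n.
  have [i hi] := prim_rootP v_prim h2N; exists i => //.
  rewrite /bad -hi hN eqxx /=.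
  by apply/forallP => j; apply/eqP => hj; apply: h_bad; exists j.
have [i vi] : exists i, v = w ^+ i.
  have [/existsP[i /eqP] | v_bad] := boolP [exists i : 'I_(2 * N), v == w ^+ i].
    by exists i.
  have [|i0 bad0 _] := badP v vN.
    case=> i vi; case/existsP: v_bad.
    by exists (inord (i %% (2 * N))); rewrite inordK ?ltn_pmod // -wv_mod -vi.
  have Rreal : {in bad, forall j : 'I_(2 * N), 'Re (v ^+ j) \is Num.real}.
    by move=> j _; apply: Creal_Re.
  case: (real_arg_maxP bad0 Rreal) => i /andP[/eqP hi /forallP i_bad] i_max.
  have [||h' [hN h_bad] lt_h] := better (v ^+ i) => //.
    case=> j hj; case/negP: (i_bad (inord (j %% (2 * N)))).
    by rewrite inordK ?ltn_pmod // -wv_mod -hj.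
  have [j bad_j h'E] := badP h' hN h_bad; move: lt_h.
  by rewrite h'E real_ltNge ?Creal_Re //; have /= -> := i_max j bad_j.
(* Since [v] is a power of [w], the order of [w] is a multiple of 2N; hence it equals 2N, and
   [w ^+ 2] has order N. *)
have [m w_prim m_dvd] := prim_order_exists (isT : (0 < 2 * N)%N) w2N.
have {m_dvd} m2N : m = (2 * N)%N.
  apply/eqP; rewrite eqn_dvd m_dvd (prim_order_dvd v_prim) vi -exprM mulnC.
  by rewrite exprM (prim_expr_order w_prim) expr1n eqxx.
have /gcdn_idPl dvd2 : (2 %| 2 * N)%N by rewrite dvdn_mulr.
by have := exp_prim_root w_prim 2; rewrite m2N dvd2 mulKn.
Qed.

(** * The quaternion group of order 8 and its rotation of order three *)

(* [(e, a, b)] encodes [x ^+ (2 * e + a) * y ^+ b]. *)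
Notation quat := (bool * bool * bool)%type.

(** With -1 = x^2 central, the three sign corrections come from x x = -1, y x = - x y and y y =
    -1. *)
Definition quat_mul (p q : quat) : quat :=
  let: (e, a, b) := p in let: (e', a', b') := q in
  (e (+) e' (+) (a && a') (+) (b && a') (+) (b && b'), a (+) a', b (+) b').

(** Conjugation by z, the cycle x -> y -> xy -> x. *)
Definition quat_rot (q : quat) : quat := let: (e, a, b) := q in (e, b, a (+) b).

Definition quats : seq quat :=
  [:: (false, false, false); (false, true, false); (false, false, true);
      (false, true, true); (true, false, false); (true, true, false);
      (true, false, true); (true, true, true)].

Lemma mem_quats q : q \in quats.
Proof. by case: q => [[[] []] []]. Qed.

Lemma iter_quat_rot n q : iter n quat_rot q = iter (n %% 3)%N quat_rot q.
Proof.
rewrite {1}(divn_eq n 3) addnC iterD; congr iter.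
have rot3 : iter 3 quat_rot q = q by case: q => [[[] []] []].
by elim: (n %/ 3)%N => // m; rewrite mulSn iterD => ->.
Qed.

(** * Normal-form words over an abstract multiplication *)

Section Words.

Variables (T : Type) (one : T) (mul : T -> T -> T).
Local Notation "x * y" := (mul x y).

(** A bare carrier, without inverses, lets the same words be read in the group and in matrix
    algebras. *)
Definition quat_word (x y : T) (q : quat) : T :=
  let: (e, a, b) := q in
  (if e then x * x else one) * (if a then x else one) * (if b then y else one).

Definition word (x y z : T) (q : quat) (c : nat) : T :=
  quat_word x y q * iter c (mul z) one.

Hypotheses (mulA : associative mul) (mul1 : left_id one mul).
Hypothesis mulr1 : right_id one mul.

Variables x y z : T.
Hypotheses (x4 : x * x * (x * x) = one) (y2 : y * y = x * x).
Hypotheses (yx : y * x = x * x * x * y) (zx : z * x = y * z).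
Hypothesis zy : z * y = x * y * z.

(** Each relation is restated in front of a tail [t], so that it rewrites anywhere inside a product
    associated to the right. The rules push [y] right past [x], and [z] right past both. *)
Let x4l t : x * (x * (x * (x * t))) = t.
Proof.
transitivity (x * x * (x * x) * t); first by rewrite !mulA.
by rewrite x4 mul1.
Qed.
Let y2l t : y * (y * t) = x * (x * t).
Proof. by rewrite !mulA y2. Qed.
Let yxl t : y * (x * t) = x * (x * (x * (y * t))).
Proof. by rewrite !mulA yx. Qed.
Let zxl t : z * (x * t) = y * (z * t).
Proof. by rewrite !mulA zx. Qed.
Let zyl t : z * (y * t) = x * (y * (z * t)).
Proof. by rewrite !mulA zy. Qed.

Lemma quat_wordM p q :
  quat_word x y p * quat_word x y q = quat_word x y (quat_mul p q).
Proof.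
(* Appending [one] gives every letter the tail that the rewrite rules expect. *)
rewrite -[LHS]mulr1 -[RHS]mulr1.
by case: p q => [[[] []] []] [[[] []] []]; rewrite /quat_word /=;
  rewrite -?mulA ?mul1;
  rewrite ?(yxl, y2l, x4l).
Qed.

Lemma quat_word_rot q : z * quat_word x y q = quat_word x y (quat_rot q) * z.
Proof.
rewrite -[LHS]mulr1 -[RHS]mulr1.
by case: q => [[[] []] []]; rewrite /quat_word /=;
  rewrite -?mulA ?mul1;
  rewrite ?(zxl, zyl) ?(yxl, y2l, x4l).
Qed.

(** Each of the [c] letters [z] crosses the quaternion part of the second word at the cost of one
    rotation. *)
Lemma wordM p c q d :
  word x y z p c * word x y z q d =
  word x y z (quat_mul p (iter c quat_rot q)) (c + d)%N.
Proof.
rewrite /word -quat_wordM -!mulA; congr (_ * _).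
elim: c => [|c IHc] /=; first by rewrite mul1.
by rewrite -mulA IHc !mulA quat_word_rot.
Qed.

Lemma word_x : word x y z (false, true, false) 0 = x.
Proof. by rewrite /word /= !mul1 !mulr1. Qed.
Lemma word_y : word x y z (false, false, true) 0 = y.
Proof. by rewrite /word /= !mul1 !mulr1. Qed.
Lemma word_z : word x y z (false, false, false) 1 = z.
Proof. by rewrite /word /= !mul1 !mulr1. Qed.
Lemma word_1 : word x y z (false, false, false) 0 = one.
Proof. by rewrite /word /= !mul1. Qed.

Lemma word_mod N q c :
  iter N (mul z) one = one -> word x y z q (c %% N)%N = word x y z q c.
Proof.
move=> zN; rewrite {2}(divn_eq c N) /word addnC iterD.
suff -> : iter (c %/ N * N) (mul z) one = one by [].
by elim: (c %/ N)%N => //= m IHm; rewrite mulSn iterD IHm.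
Qed.

End Words.

Lemma homGrp_of_relations N (gT : finGroupType) (x y z : gT) :
    (x ^+ 2 = (x * y) ^+ 2)%g -> ((x * y) ^+ 2 = y ^+ 2)%g ->
    (z * x * z^-1 = y)%g -> (z * y * z^-1 = x * y)%g -> (z ^+ N = 1)%g ->
  (<[x]> <*> <[y]> <*> <[z]> \homg Grp (x : y : z :
        (x ^+ 2 = (x * y) ^+ 2 = y ^+ 2, z * x * z^-1 = y, z * y * z^-1 = x * y,
         z ^+ N = 1)))%g.
Proof.
move=> e1 e2 e3 e4 e5; apply/existsP; exists (x, y, z).
by rewrite /= !xpair_eqE e1 e2 e3 e4 e5 !eqxx.
Qed.

(** * A permutation model bounding the order from below *)

Section Model.

Variable N : nat.
Hypotheses (N_gt0 : (0 < N)%N) (N3 : (3 %| N)%N).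

Let state := (quat * 'I_N)%type.

(** The state (q, c) stands for q z^c with c modulo [N]; [left_mul] and [left_rot] are left
    multiplication by a quaternion and by z. *)
Definition left_mul (p : quat) (t : state) : state := (quat_mul p t.1, t.2).
Definition left_rot (t : state) : state := (quat_rot t.1, ordS t.2).

Lemma left_mul_inj p : injective (left_mul p).
Proof.
move=> [q c] [q' c'] [+ ->].
by case: p q q' => [[[] []] []] [[[] []] []] [[[] []] []].
Qed.

Lemma left_rot_inj : injective left_rot.
Proof.
move=> [q c] [q' c'] e; have /= := congr1 fst e.
have /= /ordS_inj -> := congr1 snd e.
by case: q q' {e} => [[[] []] []] [[[] []] []].
Qed.

Definition perm_x := perm (@left_mul_inj (false, true, false)).
Definition perm_y := perm (@left_mul_inj (false, false, true)).
Definition perm_z := perm left_rot_inj.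

(** Permutations compose from left to right, so left multiplications reverse products; taking
    inverses restores the relations. *)
Definition model_group := (<[perm_x^-1]> <*> <[perm_y^-1]> <*> <[perm_z^-1]>)%G.

(** The successor on ['I_N] has order dividing [N], and so has the rotation because 3 divides
    [N]. *)
Lemma perm_z_order : (perm_z ^+ N = 1)%g.
Proof.
apply/permP => -[q c]; rewrite permX perm1.
have -> m : iter m perm_z (q, c) = (iter m quat_rot q, iter m (@ordS N) c).
  by elim: m => //= m ->; rewrite permE.
congr (_, _).
  by rewrite iter_quat_rot (eqP N3).
apply: val_inj => /=; have -> m : iter m (@ordS N) c = ((c + m) %% N)%N :> nat.
  elim: m => [|m IHm]; first by rewrite addn0 modn_small.
  by rewrite /= IHm addnS -addn1 modnDml addn1.
by rewrite modnDr modn_small.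
Qed.

Lemma model_group_hom :
  (model_group \homg Grp (x : y : z :
        (x ^+ 2 = (x * y) ^+ 2 = y ^+ 2, z * x * z^-1 = y, z * y * z^-1 = x * y,
         z ^+ N = 1)))%g.
Proof.
have rel (a b c : {perm state}) :
    (a * c = c * b -> c^-1 * a^-1 * c^-1^-1 = b^-1)%g.
  move=> e; rewrite invgK; apply: (mulgI c); rewrite !mulgA mulgV mul1g.
  by apply: (mulgI a); rewrite mulKVg !mulgA e mulgK.
have xz : (perm_x * perm_z = perm_z * perm_y)%g.
  by apply/permP => -[[[[] []] []] c]; rewrite !permE /= !permE.
have yz : (perm_y * perm_z = perm_z * (perm_y * perm_x))%g.
  by apply/permP => -[[[[] []] []] c]; rewrite !permE /= !permE /= !permE.
have y2 : (perm_x ^+ 2 = perm_y ^+ 2)%g.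
  by apply/permP => -[[[[] []] []] c]; rewrite !permX /= !permE.
have xy2 : ((perm_y * perm_x) ^+ 2 = perm_y ^+ 2)%g.
  by apply/permP => -[[[[] []] []] c];
    rewrite !(expgS _ 1) !expg1 !permM !permE.
apply: homGrp_of_relations.
- by rewrite -invMg !expgVn y2 xy2.
- by rewrite -invMg !expgVn xy2.
- exact: rel xz.
- by rewrite -[RHS]invMg; apply: rel yz.
by rewrite expgVn perm_z_order invg1.
Qed.

(** The group is transitive on the 8N states, and an orbit is no larger than the group: powers of z
    reach every (1, c), then y and x reach every quaternion. *)
Lemma card_model_group : (8 * N <= #|model_group|)%N.
Proof.
have -> : (8 * N)%N = #|{: state}| by rewrite !card_prod !card_bool card_ord.
pose t0 : state := ((false, false, false), Ordinal N_gt0).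
have sub : [set: state] \subset orbit 'P model_group t0.
  have closed (s : {perm state}) t : s^-1%g \in model_group ->
      t \in orbit 'P model_group t0 -> s t \in orbit 'P model_group t0.
    rewrite groupV => sH /orbitP[h hH <-]; apply/orbitP; exists (h * s)%g.
      by rewrite groupM.
    by rewrite /= !apermE permM.
  have xH : (perm_x^-1)%g \in model_group.
    by rewrite /= !mem_gen // !inE mem_gen // !inE cycle_id.
  have yH : (perm_y^-1)%g \in model_group.
    by rewrite /= !mem_gen // !inE mem_gen // !inE cycle_id orbT.
  have zH : (perm_z^-1)%g \in model_group.
    by rewrite /= !mem_gen // !inE cycle_id orbT.
  have zO c : (false, false, false, c) \in orbit 'P model_group t0.
    case: c; elim=> [|m IHm] lt_mN.
      rewrite (_ : Ordinal lt_mN = Ordinal N_gt0) ?orbit_refl //.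
      exact: val_inj.
    have := closed _ _ zH (IHm (ltnW lt_mN)); rewrite permE /left_rot /=.
    rewrite (_ : ordS _ = Ordinal lt_mN) //; apply: val_inj.
    by rewrite /= modn_small.
  apply/subsetP => -[q c] _.
  have xO p : (p, c) \in orbit 'P model_group t0 ->
      (quat_mul (false, true, false) p, c) \in orbit 'P model_group t0.
    by move/(closed _ _ xH); rewrite permE.
  have yO p : (p, c) \in orbit 'P model_group t0 ->
      (quat_mul (false, false, true) p, c) \in orbit 'P model_group t0.
    by move/(closed _ _ yH); rewrite permE.
  have {zO} h := zO c.
  have {yO} h' := yO _ h.
  case: q => [[[] []] []].
  - exact: (xO _ (xO _ (xO _ h'))).
  - exact: (xO _ (xO _ (xO _ h))).
  - exact: (xO _ (xO _ h')).
  - exact: (xO _ (xO _ h)).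
  - exact: (xO _ h').
  - exact: (xO _ h).
  - exact: h'.
  exact: h.
by rewrite -cardsT (leq_trans (subset_leq_card sub)) ?leq_imset_card.
Qed.

End Model.

(** * Conjugacy and class functions at the level of quaternions *)

(** This is (p z^c)(g z^d) = (g z^d)(q z^c) for c = r mod 3, after cancelling the common power of z:
    conjugacy of p z^c and q z^c. Rotation has order three, so d < 3 suffices. *)
Definition quat_conj (r : nat) (p q : quat) : bool :=
  has (fun g => has (fun d => quat_mul p (iter r quat_rot g) ==
                              quat_mul g (iter d quat_rot q)) (iota 0 3)) quats.

Lemma iter_mulg (gT : finGroupType) (z : gT) c :
  iter c (mulg z) 1%g = (z ^+ c)%g.
Proof. by elim: c => //= c ->; rewrite expgS. Qed.

(* [(r, qs)] stands for the class [qs * z ^+ (3 * l + r)], in the order of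
   [class_sets]. *)
Definition class_table : seq (nat * seq quat) :=
  let q e a b : quat := (e, a, b) in
  let one := q false false false in
  let x1 := q false true false in
  let y1 := q false false true in
  let xy := q false true true in
  let x2 := q true false false in
  let x3 := q true true false in
  let x2y := q true false true in
  let x3y := q true true true in
  [:: (0, [:: one]); (0, [:: x2]);
      (1, [:: one; x3; x2y; x3y]); (2, [:: one; x1; y1; xy]);
      (1, [:: x1; x2; y1; xy]); (2, [:: x2; x3; x2y; x3y]);
      (0, [:: x1; y1; x3; xy; x2y; x3y])]%N.

Lemma class_setsE (gT : finGroupType) (x y z : gT) l :
  class_sets x y z l =
  [seq [set g in [seq word 1%g mulg x y z q (3 * l + p.1) | q <- p.2]]
    | p <- class_table].
Proof.
have wE q c : word 1%g mulg x y z q c = 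
  (quat_word 1%g mulg x y q * z ^+ c)%g by rewrite /word iter_mulg.
rewrite /= addn0; congr [:: _; _; _; _; _; _; _]; apply/setP => g;
  rewrite !inE !wE /= ?mulg1 ?mul1g -?orbA -?(expgS x 1) -?(expgSr x 2) //.
Qed.

(** [v] has one entry per row of [class_table]. For each r < 3 the rows of residue r partition the
    eight quaternions, so exactly one row is found. *)
Definition class_fun (v : seq int) (q : quat) (r : nat) : int :=
  nth 0 v (find (fun p => (p.1 == r) && (q \in p.2)) class_table).

(** Only 24 pairs (r, q) occur, and the class of each is computed. *)
Lemma class_table_conj r q : (r < 3)%N -> exists2 p, p \in class_table &
  p.1 = r /\ p.2 =i [seq p <- quats | quat_conj r q p].
Proof.
have : all (fun r => all (fun q => has (fun p => (p.1 == r) &&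
    perm_eq p.2 [seq p <- quats | quat_conj r q p]) class_table) quats)
  (iota 0 3) by vm_compute.
move=> /allP H lt_r; have /H/allP/(_ q (mem_quats q)) : r \in iota 0 3.
  by rewrite mem_iota.
case/hasP=> p p_in /andP[/eqP pr /perm_mem e]; exists p => //.
Qed.

Lemma sum_mod3 M m (F : nat -> algC) : M = (m * 3)%N ->
  \sum_(c < M) F (c %% 3)%N = (F 0%N + F 1%N + F 2%N) *+ m.
Proof.
move=> ->; elim: m => [|m IHm]; first by rewrite mul0n big_ord0.
rewrite mulSn addnC -(big_mkord xpredT (fun c => F (c %% 3)%N)) /=.
rewrite !addnS addn0 !big_nat_recr //= big_mkord IHm mulrSr.
rewrite -[(m * 3).+2]addn2 -[(m * 3).+1]addn1 !modnMDl modnMl.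
by rewrite !addrA.
Qed.

(** * The group: normal form, order, classes, and representations from matrices *)

Section Group.

Variables (k : nat) (gT : finGroupType) (G : {group gT}) (x y z : gT).
Hypotheses (k_gt0 : (0 < k)%N) (hG : P'8_3 k G x y z).

Let N := (3 ^ k)%N.
Let N_gt0 : (0 < N)%N. Proof. by rewrite expn_gt0. Qed.
Let N3 : (3 %| N)%N. Proof. exact: dvdn_exp. Qed.

Local Notation W := (word 1%g mulg x y z).

Let zN : (z ^+ N)%g = 1%g. Proof. by case: hG => _ _ []. Qed.

Lemma relation_y2 : (y * y = x * x)%g.
Proof. by case: hG => _ _ [e1 e2 _ _ _]; move: e2; rewrite -e1. Qed.

Lemma relation_yxy : (y * x * y = x)%g.
Proof.
case: hG => _ _ [e _ _ _ _]; apply: (mulgI x).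
by move: e; rewrite !(expgS _ 1) !expg1 !mulgA.
Qed.

(* [y] inverts [x], but fixes [x ^+ 2 = y ^+ 2]. *)
Lemma relation_x4 : (x * x * (x * x) = 1)%g.
Proof.
have yyx : (x * y * x = y)%g.
  apply: (mulIg y); rewrite -!mulgA [(y * (x * y))%g]mulgA relation_yxy.
  by rewrite relation_y2.
have xy : (x * y = y * x^-1)%g by rewrite -{2}yyx mulgK.
have x2y : (x * x * y = y * (x^-1 * x^-1))%g.
  by rewrite -mulgA xy !mulgA xy.
have : (x * x * y = y * (x * x))%g by rewrite -relation_y2 mulgA.
rewrite x2y => /mulgI e; rewrite -{1}e -mulgA mulKg.
by rewrite mulVg.
Qed.

Lemma relation_yx : (y * x = x * x * x * y)%g.
Proof.
have e : (y^-1 = x * x * y)%g.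
  by apply: (mulIg y); rewrite mulVg -mulgA relation_y2 relation_x4.
by rewrite -[LHS](mulgK y) relation_yxy e !mulgA.
Qed.

Lemma relation_zx : (z * x = y * z)%g.
Proof. by case: hG => _ _ [_ _ <- _ _]; rewrite mulgKV. Qed.

Lemma relation_zy : (z * y = x * y * z)%g.
Proof. by case: hG => _ _ [_ _ _ <- _]; rewrite mulgKV. Qed.

Lemma group_wordM p c q d :
  (W p c * W q d)%g = W (quat_mul p (iter c quat_rot q)) (c + d).
Proof.
apply: wordM; [exact: mulgA | exact: mul1g | exact: mulg1 | exact: relation_x4
 | exact: relation_y2 | exact: relation_yx | exact: relation_zx
 | exact: relation_zy].
Qed.

Lemma group_word_mod q c : W q (c %% N) = W q c.
Proof. by apply: word_mod; rewrite iter_mulg. Qed.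

Let wordN (t : quat * 'I_N) := W t.1 t.2.

(** The words contain the generators and are closed under products, hence form a subgroup containing
    [G]. *)
Lemma group_wordP g : g \in G -> exists t, g = wordN t.
Proof.
have modN c : (c %% N < N)%N by rewrite ltn_mod.
have wordN_mod q c : W q c = wordN (q, Ordinal (modN c)).
  by rewrite /wordN /= group_word_mod.
have grS : group_set [set wordN t | t in [set: quat * 'I_N]].
  apply/group_setP; split.
    rewrite -(@word_1 _ _ _ (@mul1g gT) x y z) wordN_mod.
    exact: imset_f.
  move=> _ _ /imsetP[t _ ->] /imsetP[t' _ ->].
  by rewrite /wordN group_wordM wordN_mod imset_f.
have GS : G \subset group grS.
  case: hG => _ -> _; rewrite gen_subG; apply/subsetP => h.
  have [xW yW zW] : [/\ x = W (false, true, false) 0,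
      y = W (false, false, true) 0 & z = W (false, false, false) 1].
    by split; rewrite ?word_x ?word_y ?word_z // => ?; rewrite ?mulg1 ?mul1g.
  rewrite !inE -orbA => /or3P[] /eqP ->.
  - by rewrite xW wordN_mod imset_f.
  - by rewrite yW wordN_mod imset_f.
  by rewrite zW wordN_mod imset_f.
move=> Gg; have /imsetP[t _ ->] := subsetP GS g Gg; by exists t.
Qed.

Lemma group_wordG q c : W q c \in G.
Proof.
have [xG yG zG] : [/\ x \in G, y \in G & z \in G].
  by case: hG => _ -> _; rewrite !mem_gen ?inE ?eqxx ?orbT.
have iG : iter c (mulg z) 1%g \in G by rewrite iter_mulg groupX.
by rewrite /word groupM //; case: q => [[[] []] []]; rewrite !groupM.
Qed.

(** The presentation enters here: [model_group] satisfies the relations, so it is a homomorphic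
    image of [G]. *)
Lemma leq_card_group : (8 * N <= #|G|)%N.
Proof.
have [isoG _ _] := hG; apply: leq_trans (card_model_group N_gt0) _.
apply: dvdn_leq (cardG_gt0 G) _; apply: card_homg.
by rewrite isoG; apply: model_group_hom.
Qed.

(** The 8N words cover a group of at least 8N elements, so no two coincide. *)
Lemma wordN_inj : injective wordN.
Proof.
have GS : G \subset [set wordN t | t in [set: quat * 'I_N]].
  by apply/subsetP => g /group_wordP[t ->]; rewrite imset_f.
suff : {in [set: quat * 'I_N] &, injective wordN}.
  by move=> inj t t'; apply: inj; rewrite inE.
apply/imset_injP; rewrite eqn_leq leq_imset_card cardsT.
rewrite !card_prod !card_bool card_ord; apply: leq_trans leq_card_group _.
exact: subset_leq_card.
Qed.

Lemma group_word_inj q c q' c' :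
  W q c = W q' c' -> q = q' /\ (c = c' %[mod N]).
Proof.
have modN d : (d %% N < N)%N by rewrite ltn_mod.
rewrite -group_word_mod -[RHS]group_word_mod => e.
have [] := @wordN_inj (q, Ordinal (modN c)) (q', Ordinal (modN c')) e.
by [].
Qed.

Lemma card_group : #|G| = (8 * N)%N.
Proof.
apply/eqP; rewrite eqn_leq leq_card_group andbT.
have <- : #|{: quat * 'I_N}| = (8 * N)%N.
  by rewrite !card_prod !card_bool card_ord.
rewrite -cardsT; apply: leq_trans (leq_imset_card wordN _).
apply: subset_leq_card; apply/subsetP => g /group_wordP[t ->].
by rewrite imset_f.
Qed.

Lemma sum_group (F : gT -> algC) :
  \sum_(g in G) F g = \sum_(c < N) \sum_(q : bool * bool * bool) F (W q c).
Proof.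
have -> : \sum_(g in G) F g =
          \sum_(g in [set wordN t | t in [set: quat * 'I_N]]) F g.
  apply: eq_bigl => g; apply/idP/imsetP => [/group_wordP[t ->]|[t _ ->]].
    by exists t.
  exact: group_wordG.
rewrite big_imset /=; last by move=> t t' _ _; apply: wordN_inj.
rewrite exchange_big pair_big /=; apply: eq_big => [t|t _] //.
by rewrite inE.
Qed.

Lemma group_word_x : W (false, true, false) 0 = x.
Proof. by apply: word_x => ?; rewrite ?mulg1 ?mul1g. Qed.
Lemma group_word_y : W (false, false, true) 0 = y.
Proof. by apply: word_y => ?; rewrite ?mulg1 ?mul1g. Qed.
Lemma group_word_z : W (false, false, false) 1 = z.
Proof. by apply: word_z => ?; rewrite ?mulg1 ?mul1g. Qed.
Lemma group_word_1 : W (false, false, false) 0 = 1%g.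
Proof. by apply: word_1 => ?; rewrite ?mulg1 ?mul1g. Qed.

Lemma word_repr n (X Y Z : 'M[algC]_n) :
    X *m X *m (X *m X) = 1%:M -> Y *m Y = X *m X ->
    Y *m X = X *m X *m X *m Y -> Z *m X = Y *m Z -> Z *m Y = X *m Y *m Z ->
    iter N (mulmx Z) 1%:M = 1%:M ->
  exists rG : mx_representation algC G n,
    forall q c, rG (W q c) = word 1%:M mulmx X Y Z q c.
Proof.
move=> X4 Y2 YX ZX ZY ZN; pose W' := word 1%:M mulmx X Y Z.
(* The [pick] inverts [wordN], which is injective; 0 is the default outside [G]. *)
pose r g := if [pick t | wordN t == g] is Some t then W' t.1 t.2 else 0.
have rW q c : r (W q c) = W' q c.
  rewrite /r; case: pickP => [[q' c'] /eqP | none].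
    case/group_word_inj=> -> /= e.
    by rewrite -[W' q c](word_mod _ _ _ _ ZN) -e word_mod.
  have modN : (c %% N < N)%N by rewrite ltn_mod.
  have := none (q, Ordinal modN).
  by rewrite /wordN /= group_word_mod eqxx.
have rM : mx_repr G r.
  split; first by rewrite -group_word_1 rW; apply: word_1 => ?; rewrite mul1mx.
  move=> _ _ /group_wordP[t ->] /group_wordP[t' ->].
  rewrite /wordN group_wordM !rW; apply/esym.
  by apply: wordM => //; [apply: mulmxA | apply: mul1mx | apply: mulmx1].
by exists (MxRepresentation rM).
Qed.

Lemma class_group_word q c :
  (W q c ^: G)%g =
  [set g in [seq W p c | p <- quats & quat_conj (c %% 3) q p]].
Proof.
apply/setP => h; rewrite inE; apply/imsetP/mapP => [[g Gg ->] | [p]].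
  have [[u d] gE] := group_wordP Gg.
  have [[p c'] pE] := group_wordP (groupJ (group_wordG q c) Gg).
  (* Comparing the normal forms of both sides, the quaternion parts give [quat_conj] and the
     exponents give c = c' modulo [N]. *)
  have : (W q c * g = g * (W q c ^ g))%g by rewrite conjgE mulKVg.
  rewrite pE gE /wordN !group_wordM => /group_word_inj[e /eqP].
  move: e; rewrite [(_, _).1]/fst [(_, _).1]/fst ![(_, _).2]/snd => e.
  rewrite addnC eqn_modDl => /eqP ecc'.
  exists p; last by rewrite -[LHS]group_word_mod -ecc' group_word_mod.
  rewrite mem_filter mem_quats andbT; apply/hasP; exists u.
    exact: mem_quats.
  apply/hasP; exists (d %% 3)%N; first by rewrite mem_iota ltn_mod.
  by rewrite -!iter_quat_rot e.
rewrite mem_filter => /andP[/hasP[u _ /hasP[d _ /eqP e]] _] ->.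
exists (W u d); first exact: group_wordG.
apply: (mulgI (W u d)); rewrite conjgE mulKVg !group_wordM -e.
by rewrite -iter_quat_rot addnC.
Qed.

Let N_eq : N = (3 ^ k.-1 * 3)%N.
Proof. by rewrite -expnSr prednK. Qed.

(** The class of q z^c is found in the block l = c / 3. Inclusion is enough here, since counting
    later yields equality. *)
Lemma classes_sub_class_sets :
  {subset enum (classes G) <=
          flatten [seq class_sets x y z l | l <- iota 0 (3 ^ k.-1)]}.
Proof.
move=> C; rewrite mem_enum => /imsetP[g Gg ->].
have [[q c] ->] := group_wordP Gg.
apply/flatten_mapP; exists (c %/ 3)%N.
  by rewrite mem_iota /= ltn_divLR // -N_eq.
rewrite class_setsE class_group_word.
have [|p p_in [pr pq]] := @class_table_conj (c %% 3) q.
  by rewrite ltn_mod.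
apply/mapP; exists p => //; apply/setP => h; rewrite !inE pr mulnC -divn_eq /=.
by apply: eq_mem_map.
Qed.

(** Scaling [Z], whose cube is 1, by an N-th root of unity [a] preserves the relations and
    multiplies the trace at q z^c by a^c, of modulus 1. The squared norm is thus 24 * 3^(k-1) / (8 *
    3^k) = 1. *)
Lemma irr_repr_of_table n (X Y Z : 'M[algC]_n) (a : algC) (v : seq int) :
    X *m X *m (X *m X) = 1%:M -> Y *m Y = X *m X ->
    Y *m X = X *m X *m X *m Y -> Z *m X = Y *m Z -> Z *m Y = X *m Y *m Z ->
    Z *m (Z *m Z) = 1%:M -> a ^+ N = 1 ->
    (forall q r, (r < 3)%N ->
      \tr (word 1%:M mulmx X Y Z q r) = (class_fun v q r)%:~R) ->
    \sum_(r < 3) \sum_(q : quat) (class_fun v q r) ^+ 2 = 24%:Z ->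
  exists rG : mx_representation algC G n,
    [/\ rG x = X, rG y = Y, rG z = a *: Z, cfRepr rG \in irr G &
        forall q c, cfRepr rG (W q c) = a ^+ c * (class_fun v q (c %% 3))%:~R].
Proof.
move=> X4 Y2 YX ZX ZY Z3 aN trv sumv.
have iterZ m (U : 'M_n) b :
    iter m (mulmx (b *: Z)) U = b ^+ m *: iter m (mulmx Z) U.
  elim: m => /= [|m ->]; first by rewrite scale1r.
  by rewrite -scalemxAl -scalemxAr scalerA exprS.
have iterZ3 c : iter c (mulmx Z) 1%:M = iter (c %% 3) (mulmx Z) 1%:M.
  rewrite {1}(divn_eq c 3) addnC iterD; congr iter.
  by elim: (c %/ 3)%N => // m IHm; rewrite mulSn iterD IHm /= mulmx1.
have ZX' : (a *: Z) *m X = Y *m (a *: Z) by rewrite -scalemxAl ZX scalemxAr.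
have ZY' : (a *: Z) *m Y = X *m Y *m (a *: Z).
  by rewrite -scalemxAl ZY scalemxAr.
have ZN' : iter N (mulmx (a *: Z)) 1%:M = 1%:M.
  by rewrite iterZ aN scale1r iterZ3 N_eq modnMl.
have [rG rGE] := word_repr X4 Y2 YX ZX' ZY' ZN'.
have val q c : cfRepr rG (W q c) = a ^+ c * (class_fun v q (c %% 3))%:~R.
  rewrite cfunE group_wordG mulr1n rGE /word iterZ -scalemxAr mxtraceZ.
  by rewrite iterZ3 trv ?ltn_mod.
exists rG; split => //.
- by rewrite -{1}group_word_x rGE; apply: word_x => ?; rewrite ?mulmx1 ?mul1mx.
- by rewrite -{1}group_word_y rGE; apply: word_y => ?; rewrite ?mulmx1 ?mul1mx.
- by rewrite -{1}group_word_z rGE; apply: word_z => ?; rewrite ?mulmx1 ?mul1mx.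
rewrite irrEchar cfRepr_char cfdotE card_group sum_group.
have a1 : `|a| = 1.
  by apply/eqP; rewrite -(@pexpr_eq1 _ _ N) ?expn_gt0 // -normrX aN normr1.
(* With |a| = 1 the inner sum depends on c mod 3 only, and each residue occurs 3^(k-1) times. *)
rewrite (eq_bigr (fun c : 'I_N =>
   (\sum_(q : quat) (class_fun v q (c %% 3)%N) ^+ 2)%:~R)) => [|c _].
  pose S r := \sum_(q : quat) class_fun v q r ^+ 2.
  rewrite (sum_mod3 (fun r => (S r)%:~R) N_eq).
  have -> : (S 0)%:~R + (S 1)%:~R + (S 2)%:~R = 24%:Z%:~R :> algC.
    by rewrite -sumv 3!big_ord_recl big_ord0 addr0 !rmorphD /= addrA.
  have -> : 24%:Z%:~R *+ 3 ^ k.-1 = (8 * 3 ^ k)%:R :> algC.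
    by rewrite -[24%:Z%:~R]/((8 * 3)%:R) -mulrnA -mulnA -expnS prednK.
  have N0 : (8 * 3 ^ k)%:R != 0 :> algC by rewrite pnatr_eq0 muln_eq0 expn_eq0.
  by apply/eqP; apply: mulVf.
rewrite rmorph_sum /=; apply: eq_bigr => q _; rewrite val.
rewrite rmorphM /= mulrACA -normCK normrX a1 !expr1n mul1r.
by rewrite rmorphXn expr2 /= rmorph_int.
Qed.

End Group.

(** * Computing with explicit 2 x 2 and 3 x 3 matrices *)

Lemma mx_of_rows2M (a b c d a' b' c' d' : algC) :
  mx_of_rows 2 [:: [:: a; b]; [:: c; d]]
    *m mx_of_rows 2 [:: [:: a'; b']; [:: c'; d']] =
  mx_of_rows 2 [:: [:: a * a' + b * c'; a * b' + b * d'];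
                   [:: c * a' + d * c'; c * b' + d * d']].
Proof.
apply/matrixP => -[[|[|//]] ?] [[|[|//]] ?];
  by rewrite !mxE !big_ord_recl big_ord0 !mxE addr0.
Qed.

Lemma mx_of_rows2_1 :
  1%:M = mx_of_rows 2 [:: [:: 1; 0]; [:: 0; 1]].
Proof. by apply/matrixP => -[[|[|//]] ?] [[|[|//]] ?]; rewrite !mxE. Qed.

Lemma mx_of_rows2_eq (a b c d a' b' c' d' : algC) :
    a = a' -> b = b' -> c = c' -> d = d' ->
  mx_of_rows 2 [:: [:: a; b]; [:: c; d]] =
  mx_of_rows 2 [:: [:: a'; b']; [:: c'; d']].
Proof. by move=> -> -> -> ->. Qed.

Lemma mxtrace_mx_of_rows2 (a b c d : algC) :
  \tr (mx_of_rows 2 [:: [:: a; b]; [:: c; d]]) = a + d.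
Proof. by rewrite /mxtrace !big_ord_recl big_ord0 !mxE addr0. Qed.

Lemma mx_of_rows3M (a b c d e f g h i a' b' c' d' e' f' g' h' i' : algC) :
  mx_of_rows 3 [:: [:: a; b; c]; [:: d; e; f]; [:: g; h; i]]
    *m mx_of_rows 3 [:: [:: a'; b'; c']; [:: d'; e'; f']; [:: g'; h'; i']] =
  mx_of_rows 3
    [:: [:: a * a' + b * d' + c * g'; a * b' + b * e' + c * h';
            a * c' + b * f' + c * i'];
        [:: d * a' + e * d' + f * g'; d * b' + e * e' + f * h';
            d * c' + e * f' + f * i'];
        [:: g * a' + h * d' + i * g'; g * b' + h * e' + i * h';
            g * c' + h * f' + i * i']].
Proof.
apply/matrixP => -[[|[|[|//]]] ?] [[|[|[|//]]] ?];
  by rewrite !mxE !big_ord_recl big_ord0 !mxE addr0 addrA.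
Qed.

Lemma mx_of_rows3_1 :
  1%:M = mx_of_rows 3 [:: [:: 1; 0; 0]; [:: 0; 1; 0]; [:: 0; 0; 1]].
Proof.
by apply/matrixP => -[[|[|[|//]]] ?] [[|[|[|//]]] ?]; rewrite !mxE.
Qed.

Lemma mx_of_rows3_eq (a b c d e f g h i a' b' c' d' e' f' g' h' i' : algC) :
    a = a' -> b = b' -> c = c' -> d = d' -> e = e' -> f = f' -> g = g' ->
    h = h' -> i = i' ->
  mx_of_rows 3 [:: [:: a; b; c]; [:: d; e; f]; [:: g; h; i]] =
  mx_of_rows 3 [:: [:: a'; b'; c']; [:: d'; e'; f']; [:: g'; h'; i']].
Proof. by do 9!move=> ->. Qed.

Lemma mxtrace_mx_of_rows3 (a b c d e f g h i : algC) :
  \tr (mx_of_rows 3 [:: [:: a; b; c]; [:: d; e; f]; [:: g; h; i]]) = a + e + i.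
Proof. by rewrite /mxtrace !big_ord_recl big_ord0 !mxE addr0 addrA. Qed.

(** * The integer tables and the matrices realizing them *)

Definition chi_table : seq int := [:: 1; 1; 1; 1; 1; 1; 1].
Definition psi_table : seq int := [:: 2; - 2; - 1; - 1; 1; 1; 0].
Definition phi_table : seq int := [:: 3; 3; 0; 0; 0; 0; - 1].

(** From the factorization of zeta^3 - 1; [ring] uses this to reduce polynomials in [zeta 3] when
    checking [rho]. *)
Lemma zeta3E : zeta 3 ^+ 2 = - 1 - zeta 3.
Proof.
have z3 := zeta_prim (isT : (0 < 3)%N).
have : (zeta 3 - 1) * (zeta 3 ^+ 2 + zeta 3 + 1) = 0.
  by rewrite -[RHS](subrr 1) -{3}(prim_expr_order z3); ring.
move/eqP; rewrite mulf_eq0 => /orP[|/eqP e].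
  by rewrite subr_eq0 -[zeta 3]expr1 -(prim_order_dvd z3).
by apply/eqP; rewrite -subr_eq0 -e; apply/eqP; ring.
Qed.

(** [rho_z k j] stripped of its scalar, which becomes the root of unity [a] of
    [irr_repr_of_table]. *)
Definition rho_z0 : 'M[algC]_2 :=
  mx_of_rows 2 [:: [:: 0; zeta 3]; [:: - (zeta 3 ^+ 2); -1]].
Definition sigma_z0 : 'M[algC]_3 :=
  mx_of_rows 3 [:: [:: -1; -1; -1]; [:: 0; 1; 0]; [:: 1; 0; 0]].

Lemma rho_relations :
  [/\ rho_x *m rho_x *m (rho_x *m rho_x) = 1%:M,
      rho_y *m rho_y = rho_x *m rho_x,
      rho_y *m rho_x = rho_x *m rho_x *m rho_x *m rho_y
    & [/\ rho_z0 *m rho_x = rho_y *m rho_z0,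
          rho_z0 *m rho_y = rho_x *m rho_y *m rho_z0
        & rho_z0 *m (rho_z0 *m rho_z0) = 1%:M]].
Proof.
have w2 := zeta3E.
by split; [..|split]; rewrite /rho_x /rho_y /rho_z0 ?mx_of_rows2_1
  !mx_of_rows2M;
  apply: mx_of_rows2_eq; ring: w2.
Qed.

Lemma rho_trace q r : (r < 3)%N ->
  \tr (word 1%:M mulmx rho_x rho_y rho_z0 q r) = (class_fun psi_table q r)%:~R.
Proof.
have w2 := zeta3E; case: r => [|[|[|//]]] _; case: q => [[[] []] []].
all: rewrite /class_fun /word /quat_word /= /rho_x /rho_y /rho_z0.
all: rewrite ?mx_of_rows2_1 !mx_of_rows2M mxtrace_mx_of_rows2; ring: w2.
Qed.

Lemma sigma_relations :
  [/\ sigma_x *m sigma_x *m (sigma_x *m sigma_x) = 1%:M,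
      sigma_y *m sigma_y = sigma_x *m sigma_x,
      sigma_y *m sigma_x = sigma_x *m sigma_x *m sigma_x *m sigma_y
    & [/\ sigma_z0 *m sigma_x = sigma_y *m sigma_z0,
          sigma_z0 *m sigma_y = sigma_x *m sigma_y *m sigma_z0
        & sigma_z0 *m (sigma_z0 *m sigma_z0) = 1%:M]].
Proof.
by split; [..|split]; rewrite /sigma_x /sigma_y /sigma_z0 ?mx_of_rows3_1
  !mx_of_rows3M;
  apply: mx_of_rows3_eq; ring.
Qed.

Lemma sigma_trace q r : (r < 3)%N ->
  \tr (word 1%:M mulmx sigma_x sigma_y sigma_z0 q r) =
  (class_fun phi_table q r)%:~R.
Proof.
case: r => [|[|[|//]]] _; case: q => [[[] []] []].
all: rewrite /class_fun /word /quat_word /= /sigma_x /sigma_y /sigma_z0.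
all: rewrite ?mx_of_rows3_1 !mx_of_rows3M mxtrace_mx_of_rows3; ring.
Qed.

Lemma sum_quats (F : quat -> int) : \sum_q F q = \sum_(q <- quats) F q.
Proof.
apply: perm_big; apply: uniq_perm => [||q]; first exact: index_enum_uniq.
  by vm_compute.
by rewrite mem_index_enum mem_quats.
Qed.

(** For [chi_table] and [psi_table] each residue contributes 8; for [phi_table] residue 0
    contributes 9 + 9 + 6 and the others nothing. *)
Lemma table_norms v : v \in [:: chi_table; psi_table; phi_table] ->
  \sum_(r < 3) \sum_(q : quat) (class_fun v q r) ^+ 2 = 24%:Z.
Proof.
by rewrite !inE => /or3P[] /eqP ->; rewrite !big_ord_recl big_ord0
  !sum_quats unlock; vm_compute.
Qed.

Lemma has_values_table (gT : finGroupType) (G : {group gT}) (phi : 'CF(G))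
    (x y z : gT) (a : algC) (v : seq int) l :
    size v = 7%N ->
    (forall q c, phi (word 1%g mulg x y z q c) =
                 a ^+ c * (class_fun v q (c %% 3))%:~R) ->
  has_values phi (class_sets x y z l)
    [seq a ^+ (3 * l + p.1.1) * p.2%:~R | p <- zip class_table v].
Proof.
move=> size_v phiE; rewrite class_setsE /has_values.
have : all (fun p => (p.1.1 < 3)%N &&
    all (fun q => class_fun v q p.1.1 == p.2) p.1.2) (zip class_table v).
  case: v size_v {phiE} => [|v1 [|v2 [|v3 [|v4 [|v5 [|v6 [|v7 [|]]]]]]]] // _.
  by rewrite /class_fun /= !eqxx.
have : size class_table = size v by rewrite size_v.
(* The rows are consumed together with their values, while the lookup [class_fun v] keeps the full
   list [v]. *)
elim: class_table {1 3 4}v => [|[r C] T IHT] [|t u] //= [sz].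
case/andP=> /andP[lt_r /allP Ct] /(IHT _ sz) ->; rewrite andbT.
apply/forallP => g; apply/implyP; rewrite inE => /mapP[q qC ->].
by rewrite phiE mulnC modnMDl modn_small // (eqP (Ct q qC)).
Qed.

(** * Counting characters against classes *)

Theorem mainTheorem7 (k : nat) (hk : (2 <= k)%N) (gT : finGroupType)
    (G : {group gT}) (x y z : gT) (hG : P'8_3 k G x y z) :
  (* the listed sets are the conjugacy classes of G, without repetition *)
  perm_eq (enum (classes G))
          (flatten [seq class_sets x y z l | l <- iota 0 (3 ^ k.-1)])
  /\
  exists (alpha : 'I_(3 ^ k) -> mx_representation algC G 1)
         (rho : 'I_(3 ^ k) -> mx_representation algC G 2)
         (sigma : 'I_(3 ^ k.-1) -> mx_representation algC G 3),
    [/\ forall j, [/\ alpha j x = alpha_x, alpha j y = alpha_y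
                    & alpha j z = alpha_z k j],
        forall j, [/\ rho j x = rho_x, rho j y = rho_y & rho j z = rho_z k j],
        forall s, [/\ sigma s x = sigma_x, sigma s y = sigma_y
                    & sigma s z = sigma_z k s]
      & [/\ #|Iirr G| = (7 * 3 ^ k.-1)%N,
            (* irr G has no repetition, hence neither has this list *)
            perm_eq (irr G)
              ([seq cfRepr (alpha j) | j : 'I_(3 ^ k)]
               ++ [seq cfRepr (rho j) | j : 'I_(3 ^ k)]
               ++ [seq cfRepr (sigma s) | s : 'I_(3 ^ k.-1)])
          & forall l : 'I_(3 ^ k.-1),
              [/\ forall j, has_values (cfRepr (alpha j))
                              (class_sets x y z l) (chi_values k j l),
                  forall j, has_values (cfRepr (rho j))
                              (class_sets x y z l) (psi_values k j l)
                & forall s, has_values (cfRepr (sigma s))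
                              (class_sets x y z l) (phi_values k s l)]]].
Proof.
have k_gt0 : (0 < k)%N by apply: ltnW.
have N_eq : (3 ^ k = 3 * 3 ^ k.-1)%N by rewrite -expnS prednK.
have w_prim : (3 ^ k).-primitive_root (zeta (3 ^ k)).
  by apply: zeta_prim; rewrite expn_gt0.
set w := zeta (3 ^ k) in w_prim *.
have wN j : (w ^+ j) ^+ (3 ^ k) = 1.
  by rewrite -exprM mulnC exprM (prim_expr_order w_prim) expr1n.
have Eval n (rG : mx_representation algC G n) a v (rv : forall q c,
    cfRepr rG (word 1%g mulg x y z q c) =
    a ^+ c * (class_fun v q (c %% 3))%:~R) : 
    cfRepr rG z = a * (class_fun v (false, false, false) 1)%:~R.
  by have := rv (false, false, false) 1%N; rewrite group_word_z expr1.
have /fin_all_exists[alpha alphaP] (j : 'I_(3 ^ k)) :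
    exists r : mx_representation algC G 1, [/\ r x = alpha_x, r y = alpha_y,
      r z = w ^+ j *: 1%:M, cfRepr r \in irr G
      & forall q c, cfRepr r (word 1%g mulg x y z q c) =
                    w ^+ j ^+ c * (class_fun chi_table q (c %% 3))%:~R].
  apply: (@irr_repr_of_table _ _ _ _ _ _ k_gt0 hG 1 1%:M 1%:M 1%:M _ chi_table);
    rewrite /alpha_x /alpha_y ?mulmx1 //; last exact: table_norms.
  case=> [[[] []] []] [|[|[|//]]] _;
    by rewrite /word /quat_word /= !mulmx1 mxtrace1.
have /fin_all_exists[rho rhoP] (j : 'I_(3 ^ k)) :
    exists r : mx_representation algC G 2, [/\ r x = rho_x, r y = rho_y,
      r z = w ^+ j *: rho_z0, cfRepr r \in irr G
      & forall q c, cfRepr r (word 1%g mulg x y z q c) =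
                    w ^+ j ^+ c * (class_fun psi_table q (c %% 3))%:~R].
  have [r1 r2 r3 [r4 r5 r6]] := rho_relations.
  apply: (irr_repr_of_table k_gt0 hG) => //; first exact: rho_trace.
  exact: table_norms.
have /fin_all_exists[sigma sigmaP] (s : 'I_(3 ^ k.-1)) :
    exists r : mx_representation algC G 3, [/\ r x = sigma_x, r y = sigma_y,
      r z = w ^+ s *: sigma_z0, cfRepr r \in irr G
      & forall q c, cfRepr r (word 1%g mulg x y z q c) =
                    w ^+ s ^+ c * (class_fun phi_table q (c %% 3))%:~R].
  have [r1 r2 r3 [r4 r5 r6]] := sigma_relations.
  apply: (irr_repr_of_table k_gt0 hG) => //; first exact: sigma_trace.
  exact: table_norms.
set irrs := [seq cfRepr (alpha j) | j : 'I_(3 ^ k)]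
               ++ [seq cfRepr (rho j) | j : 'I_(3 ^ k)]
               ++ [seq cfRepr (sigma s) | s : 'I_(3 ^ k.-1)].
have irrs_sub : {subset irrs <= irr G}.
  move=> phi; rewrite !mem_cat => /or3P[] /mapP[j _ ->].
  - by case: (alphaP j).
  - by case: (rhoP j).
  by case: (sigmaP j).
have w_inj (i j : 'I_(3 ^ k)) : w ^+ i = w ^+ j -> i = j.
  move/eqP; rewrite (eq_prim_root_expr w_prim) !modn_small // => /eqP.
  exact: val_inj.
have size_irrs : size irrs = (7 * 3 ^ k.-1)%N.
  by rewrite !size_cat !size_image !card_ord N_eq
    -[X in (_ + (_ + X))%N]mul1n -!mulnDl.
have alpha1 j : cfRepr (alpha j) 1%g = 1 by rewrite cfRepr1.
have rho1 j : cfRepr (rho j) 1%g = 2 by rewrite cfRepr1.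
have sigma1 j : cfRepr (sigma j) 1%g = 3 by rewrite cfRepr1.
have neq12 : 1 != 2 :> algC by rewrite (eqr_nat _ 1 2).
have neq13 : 1 != 3 :> algC by rewrite (eqr_nat _ 1 3).
have neq23 : 2 != 3 :> algC by rewrite (eqr_nat _ 2 3).
have irrs_uniq : uniq irrs.
  (* Degrees 1, 2, 3 separate the families; within [alpha] and within [rho], the values w^j and -w^j
     at z separate the members. *)
  rewrite !cat_uniq; apply/and3P; split; last (apply/and3P; split).
  - rewrite map_inj_uniq ?enum_uniq // => i j.
    move=> /(congr1 (fun phi : 'CF(G) => phi z)) /=.
    have [_ _ _ _ /Eval ->] := alphaP i; have [_ _ _ _ /Eval ->] := alphaP j.
    by rewrite /class_fun /= !mulr1; apply: w_inj.
  - apply/hasPn => phi; rewrite mem_cat => /orP[] /mapP[i _ ->].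
      apply/mapP => -[j _ /(congr1 (fun phi : 'CF(G) => phi 1%g)) /= /eqP].
      by rewrite alpha1 rho1 eq_sym (negPf neq12).
    apply/mapP => -[j _ /(congr1 (fun phi : 'CF(G) => phi 1%g)) /= /eqP].
    by rewrite alpha1 sigma1 eq_sym (negPf neq13).
  - rewrite map_inj_uniq ?enum_uniq // => i j.
    move=> /(congr1 (fun phi : 'CF(G) => phi z)) /=.
    have [_ _ _ _ /Eval ->] := rhoP i; have [_ _ _ _ /Eval ->] := rhoP j.
    by rewrite /class_fun /= !mulrN1 => /oppr_inj; apply: w_inj.
  - apply/hasPn => _ /mapP[i _ ->].
    apply/mapP => -[j _ /(congr1 (fun phi : 'CF(G) => phi 1%g)) /= /eqP].
    by rewrite rho1 sigma1 eq_sym (negPf neq23).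
  rewrite map_inj_uniq ?enum_uniq // => i j.
  (* The [sigma] characters vanish at z, so they are compared at z^3, where the value 3 w^(3s)
     determines s < 3^(k-1). *)
  move/(congr1 (fun phi : 'CF(G) =>
                  phi (word 1%g mulg x y z (false, false, false) 3))).
  have [_ _ _ _ ->] := sigmaP i; have [_ _ _ _ ->] := sigmaP j.
  have n3 :
      (class_fun phi_table (false, false, false) (3 %% 3))%:~R != 0 :> algC.
    by rewrite (_ : class_fun _ _ _ = 3) ?pnatr_eq0.
  move/(mulIf n3)/eqP; rewrite -!(exprM w) (eq_prim_root_expr w_prim) N_eq.
  rewrite ![(_ * 3)%N]mulnC -!muln_modr eqn_pmul2l // !modn_small // => /eqP.
  exact: val_inj.
have irr_uniq : uniq (irr G) by apply: free_uniq (irr_free G).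
have size_irr : size (irr G) = #|classes G| by rewrite size_tuple NirrE.
have size_sets :
    size (flatten [seq class_sets x y z l | l <- iota 0 (3 ^ k.-1)]) =
      (7 * 3 ^ k.-1)%N.
  rewrite -[in RHS](size_iota 0 (3 ^ k.-1)).
  by elim: (iota _ _) => // l s IHs; rewrite /= IHs mulnS.
have classes_sub := classes_sub_class_sets k_gt0 hG.
(* There are at least 7 * 3^(k-1) irreducible characters and at most that many classes; the two
   numbers being equal, both bounds are attained. *)
have le1 := uniq_leq_size irrs_uniq irrs_sub.
have le2 := uniq_leq_size (enum_uniq _) classes_sub.
rewrite size_irrs size_irr in le1; rewrite -cardE size_sets in le2.
have Nclasses : #|classes G| = (7 * 3 ^ k.-1)%N.
  by apply/eqP; rewrite eqn_leq le1 le2.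
split.
  (* A list without repetition, contained in one that is no longer, has the same members and forces
     the other to be free of repetition too. *)
  have [] := uniq_min_size (enum_uniq (mem (classes G))) classes_sub.
    by rewrite -cardE Nclasses size_sets.
  move=> e1 e2.
  apply: (uniq_perm _ _ e2); first exact: enum_uniq.
  by rewrite -(eq_uniq e1 e2) enum_uniq.
exists alpha, rho, sigma; split.
- move=> j; have [-> -> -> _ _] := alphaP j; split => //.
  by rewrite /alpha_z scalemx1.
- by move=> j; have [-> -> -> _ _] := rhoP j.
- by move=> s; have [-> -> -> _ _] := sigmaP s.
split.
- by rewrite card_ord NirrE.
- have [] := uniq_min_size irrs_uniq irrs_sub.
    by rewrite size_irrs size_irr Nclasses.
  move=> _ e2.
  by rewrite perm_sym; apply: uniq_perm.
move=> l; split=> [j|j|s].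
- have [_ _ _ _ /(has_values_table l (erefl : size chi_table = 7%N))]
    := alphaP j.
  by rewrite /= !mulr1 -!(exprM w) addn0 ![(j * _)%N]mulnC.
- have [_ _ _ _ /(has_values_table l (erefl : size psi_table = 7%N))]
    := rhoP j.
  rewrite /= -!(exprM w) addn0 ![(j * _)%N]mulnC.
  by rewrite !mulr1 !mulrN1 mulr0 ![w ^+ _ * _]mulrC.
have [_ _ _ _ /(has_values_table l (erefl : size phi_table = 7%N))]
    := sigmaP s.
rewrite /= -!(exprM w) addn0 ![(s * _)%N]mulnC.
by rewrite !mulr0 !mulrN1 ![w ^+ _ * _]mulrC.
Qed.
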